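(* Let $n\ge 1$ be an integer. The toric ideal $I_{K_n}$ of the complete graph $K_n$ on $n$ vertices is subgraph splittable if and only if $n\ge 4$.
   Context: Let $K$ be any field. For a finite simple graph $G$ with vertices $v_1,\dots,v_p$ and edge set $E(G)=\{e_1,\dots,e_q\}$, the edges are also used as variables of the polynomial ring $K[e_1,\dots,e_q]$, and the toric ideal $I_G\subset K[e_1,\dots,e_q]$ is the kernel of the $K$-algebra map $K[e_1,\dots,e_q]\to K[v_1,\dots,v_p]$ sending an edge $e=\{v_i,v_j\}$ to $v_iv_j$. For a subgraph $H$ of $G$ (not necessarily connected), $I_H$ is defined in the same way in the variables $E(H)$ and is regarded as the ideal it generates in $K[e_1,\dots,e_q]$. A subgraph splitting of $I_G$ is an equality $I_G=I_{G_1}+I_{G_2}$ with $G_1,G_2$ subgraphs of $G$, $I_{G_1}\neq I_G$ and $I_{G_2}\neq I_G$. $I_G$ is subgraph splittable if it has a subgraph splitting. $K_n$ is the graph with $n$ vertices in which every two distinct vertices are joined by an edge. *)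

(* Defs.v *)
From HB Require Import structures.
From mathcomp Require Import all_boot all_algebra.
From mathcomp Require Import mpoly.

Set Implicit Arguments.
Unset Strict Implicit.
Unset Printing Implicit Defensive.

Import GRing.Theory.
Local Open Scope ring_scope.

(* An edge is the set of its two end points. The vertex set need not be the
   whole of [T], so that a graph and its subgraphs live on the same type. *)
Record graph (T : finType) := Graph {
  verts : {set T};
  edges : {set {set T}};
  edgesP : forall e, e \in edges -> e \subset verts /\ #|e| = 2
}.

Definition subgraph (T : finType) (H G : graph T) : bool :=
  (verts H \subset verts G) && (edges H \subset edges G).

Lemma subgraph_edges (T : finType) (H G : graph T) :
  subgraph H G -> edges H \subset edges G.
Proof. by case/andP. Qed.

Definition complete_edges (n : nat) : {set {set 'I_n}} :=
  [set e : {set 'I_n} | #|e| == 2].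

Lemma complete_edgesP (n : nat) (e : {set 'I_n}) :
  e \in complete_edges n -> e \subset [set: 'I_n] /\ #|e| = 2.
Proof. by rewrite inE subsetT => /eqP. Qed.

Definition complete_graph (n : nat) : graph 'I_n :=
  Graph (@complete_edgesP n).

Section Ideals.
Variable R : comNzRingType.

Definition ideal_gen (S : R -> Prop) (x : R) : Prop :=
  exists (m : nat) (a s : 'I_m -> R),
    (forall i, S (s i)) /\ x = \sum_(i < m) a i * s i.

Definition ideal_add (I J : R -> Prop) (x : R) : Prop :=
  exists a b : R, [/\ I a, J b & x = a + b].

Definition ideal_eq (I J : R -> Prop) : Prop := forall x, I x <-> J x.

End Ideals.

Section ToricIdeals.
Variables (K : fieldType) (T : finType).
Implicit Types G H : graph T.

(* Edges and vertices are used as variables through the enumerations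
   [enum_val : 'I_#|edges G| -> {set T}] and [enum_val : 'I_#|verts G| -> T]. *)

Definition edge_monomial G (i : 'I_#|edges G|) : {mpoly K[#|verts G|]} :=
  \prod_(j < #|verts G| | enum_val j \in enum_val i) 'X_j.

Definition toric_map G (f : {mpoly K[#|edges G|]}) : {mpoly K[#|verts G|]} :=
  f \mPo [tuple edge_monomial i | i < #|edges G|].

Definition toric_ideal G (f : {mpoly K[#|edges G|]}) : Prop := toric_map f = 0.

(* The index in [edges G] of the [i]-th edge of the subgraph [H]. *)
Definition edge_index H G (sHG : subgraph H G) (i : 'I_#|edges H|) :
    'I_#|edges G| :=
  enum_rank_in (subsetP (subgraph_edges sHG) _ (enum_valP i)) (enum_val i).

Definition edge_ring_incl H G (sHG : subgraph H G) (f : {mpoly K[#|edges H|]}) :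
    {mpoly K[#|edges G|]} :=
  f \mPo [tuple 'X_(edge_index sHG i) | i < #|edges H|].

Definition toric_ideal_ext H G (sHG : subgraph H G) :
    {mpoly K[#|edges G|]} -> Prop :=
  ideal_gen (fun g => exists2 f : {mpoly K[#|edges H|]},
    toric_ideal f & g = edge_ring_incl sHG f).

Definition subgraph_splitting G G1 G2
    (s1 : subgraph G1 G) (s2 : subgraph G2 G) : Prop :=
  [/\ ideal_eq (@toric_ideal G)
        (ideal_add (toric_ideal_ext s1) (toric_ideal_ext s2)),
      ~ ideal_eq (toric_ideal_ext s1) (@toric_ideal G)
    & ~ ideal_eq (toric_ideal_ext s2) (@toric_ideal G)].

Definition subgraph_splittable G : Prop :=
  exists (G1 G2 : graph T) (s1 : subgraph G1 G) (s2 : subgraph G2 G),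
    subgraph_splitting s1 s2.

End ToricIdeals.

(* Main.v *)
Require Import Defs.
From mathcomp Require Import all_boot all_algebra.
From mathcomp Require Import mpoly ring.

Set Implicit Arguments.
Unset Strict Implicit.
Unset Printing Implicit Defensive.

Import GRing.Theory.
Local Open Scope ring_scope.

(** For n <= 3 the complete graph carries no four distinct vertices, and its
toric ideal is zero; the ideal of every subgraph is then zero as well, so no
splitting exists.  For n >= 4 choose distinct vertices p, q, r, s and delete the
edge pq, respectively pr: the claim is that I(K_n) = I(K_n - pq) + I(K_n - pr).

Both facts come from one statement, [toric_ideal_complete_sub]: an ideal inside
I(K_n) that contains every quadric ab.cd - ac.bd (a, b, c, d distinct) is all of
I(K_n).  A toric ideal is spanned by differences of monomials with the same
image, that is, of multigraphs with the same degree sequence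
([toric_ideal_sub_of_cong]), and two loopless multigraphs with the same degree
sequence are joined by 2-switches, each of which is a quadric times a monomial.
The connectivity is by induction on the number of edges: [create_edge] switches
a given edge of the second multigraph into the first one, after which the common
edge is cancelled.  When n <= 3 there is no quadric, so the zero ideal qualifies.

When n >= 4 the sum J of the two ideals contains all quadrics
([sum_ext_quadric]).  A quadric in which pq or pr does not occur lies in one of
the summands.  If both occur, they share the end point p, so they lie in
different terms ab.cd and ac.bd; inserting the third perfect matching ad.bc of
the four vertices then writes the quadric as a sum of two, each avoiding one of
the two edges.

Neither summand is everything ([missing_edge_ext_neq]): the ideal coming from a
subgraph H vanishes at the 0/1 point that is the indicator of E(H), whereas a
quadric whose one term contains the missing edge takes the value -1 there. *)

(** * Ideals *)

Record is_ideal (R : comNzRingType) (J : R -> Prop) : Prop := IsIdeal {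
  ideal0 : J 0;
  idealD : forall x y, J x -> J y -> J (x + y);
  idealM : forall a x, J x -> J (a * x)
}.

Lemma ideal_sum (R : comNzRingType) (J : R -> Prop) (I : Type) (r : seq I)
    (P : pred I) (F : I -> R) :
  is_ideal J -> (forall i, P i -> J (F i)) -> J (\sum_(i <- r | P i) F i).
Proof. by move=> idJ JF; elim/big_ind: _ => //; [apply: ideal0 | apply: idealD]. Qed.

Lemma ideal_gen_is_ideal (R : comNzRingType) (S : R -> Prop) :
  is_ideal (ideal_gen S).
Proof.
split=> [|x y [m [a [s [Ss ->]]]] [m' [a' [s' [Ss' ->]]]] | c x [m [a [s [Ss ->]]]]].
- have no_index (i : 'I_0) : False by case: i.
  exists 0%N, (fun=> 0), (fun i => False_rect R (no_index i)).
  by split=> [[]//|]; rewrite big_ord0.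
- exists (m + m')%N, (fun i => match split i with inl j => a j | inr j => a' j end),
    (fun i => match split i with inl j => s j | inr j => s' j end).
  split=> [i|]; first by case: split.
  by rewrite big_split_ord /=; congr (_ + _); apply: eq_bigr => i _;
     rewrite ?(unsplitK (inl _)) ?(unsplitK (inr _)).
- exists m, (fun i => c * a i), s; split=> //.
  by rewrite mulr_sumr; apply: eq_bigr => i _; rewrite mulrA.
Qed.

Lemma ideal_gen_incl (R : comNzRingType) (S : R -> Prop) x :
  S x -> ideal_gen S x.
Proof.
by move=> Sx; exists 1%N, (fun=> 1), (fun=> x); rewrite big_ord1 mul1r.
Qed.

Lemma ideal_gen_min (R : comNzRingType) (S J : R -> Prop) :
  is_ideal J -> (forall x, S x -> J x) -> forall x, ideal_gen S x -> J x.
Proof.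
move=> idJ SJ _ [m [a [s [Ss ->]]]]; apply: ideal_sum => // i _.
by apply: idealM => //; apply: SJ.
Qed.

Lemma ideal_add_is_ideal (R : comNzRingType) (I J : R -> Prop) :
  is_ideal I -> is_ideal J -> is_ideal (ideal_add I J).
Proof.
move=> idI idJ; split=> [|x y [a [b [Ia Jb ->]]] [a' [b' [Ia' Jb' ->]]]
                         | c x [a [b [Ia Jb ->]]]].
- by exists 0, 0; rewrite addr0; split=> //; exact: ideal0.
- by exists (a + a'), (b + b'); rewrite addrACA; split=> //; exact: idealD.
- by exists (c * a), (c * b); rewrite mulrDr; split=> //; exact: idealM.
Qed.

(** * Monomials modulo an ideal *)

(** Congruence of monomials, given by their exponents, modulo an ideal. *)
Definition cong (K : fieldType) m (J : {mpoly K[m]} -> Prop) (s t : 'X_{1..m}) :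
    Prop := J ('X_[s] - 'X_[t]).

Lemma addmCA n (a b c : 'X_{1..n}) : (a + (b + c) = b + (a + c))%MM.
Proof. by rewrite !addmA (addmC a). Qed.

Section Cong.
Variables (K : fieldType) (m : nat) (J : {mpoly K[m]} -> Prop).
Hypothesis idJ : is_ideal J.

Lemma cong_refl s : cong J s s.
Proof. by rewrite /cong subrr; exact: ideal0. Qed.

Lemma cong_trans t s u : cong J s t -> cong J t u -> cong J s u.
Proof.
by move=> Jst Jtu; rewrite /cong -(subrKA 'X_[t]); exact: idealD.
Qed.

Lemma congD r s t : cong J s t -> cong J (s + r) (t + r).
Proof.
by move=> Jst; rewrite /cong !mpolyXD -mulrBl mulrC; exact: idealM.
Qed.

End Cong.

(** * Toric ideals and subgraphs *)

Lemma comp_mpolyA (n k l : nat) (R : comNzRingType) (p : {mpoly R[n]})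
    (lp : n.-tuple {mpoly R[k]}) (lq : k.-tuple {mpoly R[l]}) :
  (p \mPo lp) \mPo lq = p \mPo [tuple tnth lp i \mPo lq | i < n].
Proof.
rewrite (comp_mpolyEX p) raddf_sum /= [RHS]comp_mpolyEX.
apply: eq_bigr => m _; rewrite !comp_mpolyZ; congr (_ *: _).
rewrite !comp_mpolyX rmorph_prod; apply: eq_bigr => i _ /=.
by rewrite rmorphXn /= tnth_mktuple.
Qed.


Section Toric.
Variables (K : fieldType) (T : finType).
Implicit Types G H : graph T.

Lemma toric_ideal_is_ideal G : is_ideal (@toric_ideal K T G).
Proof.
split=> [|x y|c x]; rewrite /toric_ideal /toric_map.
- exact: comp_mpoly0.
- by move=> Ix Iy; rewrite comp_mpolyD Ix Iy addr0.
- by move=> Ix; rewrite rmorphM /= Ix mulr0.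
Qed.

(** The variable of [u], as a product over the indices of [u] so that it exists
without a proof that [u] is a vertex; it is 1 off the vertex set. *)
Definition vertex_var G (u : T) : {mpoly K[#|verts G|]} :=
  \prod_(j | enum_val j == u) 'X_j.

Lemma edge_monomial_set2 G (i : 'I_#|edges G|) a b :
  a != b -> enum_val i = [set a; b] ->
  edge_monomial K i = vertex_var G a * vertex_var G b.
Proof.
move=> ab ei; rewrite /edge_monomial ei (bigID (fun j => enum_val j == a)) /=.
congr (_ * _); apply: eq_bigl => j; rewrite !inE.
  by case: eqP; rewrite ?andbF.
by case: eqP => [->|_]; rewrite ?andbT // andbF (negPf ab).
Qed.

(** The toric map commutes with the inclusion of a subgraph, once the vertex
variables of the subgraph are renamed to those of the large graph. *)
Lemma toric_map_incl H G (s : subgraph H G) (f : {mpoly K[#|edges H|]}) :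
  toric_map (edge_ring_incl s f)
  = toric_map f \mPo [tuple vertex_var G (enum_val j) | j < #|verts H|].
Proof.
rewrite /toric_map /edge_ring_incl !comp_mpolyA; congr (_ \mPo _).
apply: eq_from_tnth => i; rewrite !tnth_mktuple comp_mpolyXU -tnth_nth.
rewrite tnth_mktuple.
have [sub /eqP/cards2P[a [b [ab ei]]]] := edgesP (enum_valP i).
have ei' : enum_val (edge_index s i) = [set a; b].
  by rewrite /edge_index enum_rankK_in // (subsetP (subgraph_edges s)) ?enum_valP.
rewrite (edge_monomial_set2 ab ei') (edge_monomial_set2 ab ei) rmorphM /=.
have var_incl v : v \in enum_val i ->
    vertex_var H v \mPo [tuple vertex_var G (enum_val j) | j < #|verts H|]
    = vertex_var G v.
  move=> /(subsetP sub) vH; rewrite rmorph_prod /=.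
  rewrite (big_pred1 (enum_rank_in vH v)) => [|j /=].
    by rewrite comp_mpolyXU -tnth_nth tnth_mktuple enum_rankK_in.
  by rewrite -(inj_eq enum_val_inj) enum_rankK_in.
by rewrite !var_incl ?ei ?set21 ?set22.
Qed.

Lemma toric_ideal_ext_sub H G (s : subgraph H G) f :
  @toric_ideal_ext K T H G s f -> toric_ideal f.
Proof.
apply: ideal_gen_min; first exact: toric_ideal_is_ideal.
move=> _ [g tg ->]; rewrite /toric_ideal toric_map_incl tg.
exact: comp_mpoly0.
Qed.

(** The exponent of the variable of the edge [ab], as a sum over its indices so
that no membership proof is carried around; it is 0 when [ab] is not an edge. *)
Definition edge_exp G (a b : T) : 'X_{1..#|edges G|} :=
  (\sum_(i | enum_val i == [set a; b]) U_(i))%MM.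

Lemma edge_expC G a b : edge_exp G a b = edge_exp G b a.
Proof. by rewrite /edge_exp setUC. Qed.

Lemma edge_expE G (i : 'I_#|edges G|) a b :
  enum_val i = [set a; b] -> edge_exp G a b = U_(i)%MM.
Proof.
move=> ei; rewrite /edge_exp (big_pred1 i) // => j /=.
by rewrite -ei (inj_eq enum_val_inj).
Qed.

(** Both terms of the quadric have image [abcd]. *)
Lemma quadric_toric G a b c d : uniq [:: a; b; c; d] ->
  [set a; b] \in edges G -> [set c; d] \in edges G ->
  [set a; c] \in edges G -> [set b; d] \in edges G ->
  cong (@toric_ideal K T G) (edge_exp G a b + edge_exp G c d)
                            (edge_exp G a c + edge_exp G b d).
Proof.
rewrite /= !inE !negb_or => /and4P[/and3P[ab ac ad] /andP[bc bd] cd _].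
move=> Gab Gcd Gac Gbd.
have img x y : x != y -> [set x; y] \in edges G ->
    'X_[edge_exp G x y] \mPo [tuple edge_monomial K i | i < #|edges G|]
    = vertex_var G x * vertex_var G y.
  move=> xy Gxy; have ei := enum_rankK_in Gxy Gxy.
  rewrite (edge_expE ei) comp_mpolyXU -tnth_nth tnth_mktuple.
  exact: edge_monomial_set2.
rewrite /cong /toric_ideal /toric_map !mpolyXD comp_mpolyB !rmorphM /= !img //.
ring.
Qed.

Lemma edge_ring_incl_exp H G (s : subgraph H G) a b :
  [set a; b] \in edges H ->
  edge_ring_incl s ('X_[edge_exp H a b] : {mpoly K[_]}) = 'X_[edge_exp G a b].
Proof.
move=> Hab; have ei := enum_rankK_in Hab Hab; set i := enum_rank_in _ _ in ei.
have ei' : enum_val (edge_index s i) = [set a; b].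
  by rewrite /edge_index enum_rankK_in // (subsetP (subgraph_edges s)) ?enum_valP.
rewrite (edge_expE ei) (edge_expE ei') /edge_ring_incl comp_mpolyXU -tnth_nth.
by rewrite tnth_mktuple.
Qed.

Lemma quadric_ext H G (s : subgraph H G) a b c d : uniq [:: a; b; c; d] ->
  [set a; b] \in edges H -> [set c; d] \in edges H ->
  [set a; c] \in edges H -> [set b; d] \in edges H ->
  cong (@toric_ideal_ext K T H G s) (edge_exp G a b + edge_exp G c d)
                                    (edge_exp G a c + edge_exp G b d).
Proof.
move=> uabcd Hab Hcd Hac Hbd; apply: ideal_gen_incl.
exists ('X_[edge_exp H a b + edge_exp H c d]
        - 'X_[edge_exp H a c + edge_exp H b d]); first exact: quadric_toric.
rewrite /edge_ring_incl comp_mpolyB !mpolyXD !rmorphM /=.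
by rewrite -!/(edge_ring_incl s _) !edge_ring_incl_exp.
Qed.

(** On the variables of the subgraph the point is the image of the all-ones
point, where the elements of a toric ideal vanish. *)
Lemma toric_ideal_ext_eval H G (s : subgraph H G) f :
  @toric_ideal_ext K T H G s f ->
  f.@[fun i => (enum_val i \in edges H)%:R] = 0.
Proof.
apply: (@ideal_gen_min _ _ (fun f => f.@[_] = 0)).
  split=> [|x y ex ey|c x ex]; first exact: meval0.
    by rewrite mevalD ex ey addr0.
  by rewrite mevalM ex mulr0.
move=> _ [g tg ->]; rewrite /edge_ring_incl comp_mpoly_meval.
transitivity (toric_map g).@[fun=> 1]; last by rewrite tg meval0.
rewrite /toric_map comp_mpoly_meval.
apply: meval_eq => i; rewrite !tnth_mktuple mevalXU /edge_index.
rewrite enum_rankK_in ?(subsetP (subgraph_edges s)) ?enum_valP //.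
by rewrite rmorph_prod big1 // => j _; rewrite /= mevalXU.
Qed.

(** The quadric is evaluated at the indicator of the edges of [H]: its first term
contains the missing edge and gives 0, its second term gives 1. *)
Lemma missing_edge_ext_neq H G (s : subgraph H G) a b c d :
  uniq [:: a; b; c; d] ->
  [set a; b] \in edges G -> [set c; d] \in edges G ->
  [set a; b] \notin edges H -> [set a; c] \in edges H -> [set b; d] \in edges H ->
  ~ ideal_eq (toric_ideal_ext (K := K) s) (@toric_ideal K T G).
Proof.
move=> uabcd Gab Gcd nHab Hac Hbd extE.
have HG := subsetP (subgraph_edges s).
have /extE/toric_ideal_ext_eval := quadric_toric uabcd Gab Gcd (HG _ Hac) (HG _ Hbd).
have ev x y : [set x; y] \in edges G -> ('X_[edge_exp G x y] : {mpoly K[_]}).@[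
    fun i => (enum_val i \in edges H)%:R] = ([set x; y] \in edges H)%:R.
  move=> Gxy; have ei := enum_rankK_in Gxy Gxy.
  by rewrite (edge_expE ei) mevalXU ei.
rewrite !mpolyXD mevalB !mevalM (ev a b) // (ev c d) // (ev a c) ?(HG _ Hac) //.
rewrite (ev b d) ?(HG _ Hbd) // Hac Hbd (negPf nHab).
by rewrite mul0r mulr1 sub0r => /eqP; rewrite oppr_eq0 oner_eq0.
Qed.

(** * Binomials generate the toric ideal *)

Definition vdeg G (m : 'X_{1..#|edges G|}) (u : T) : nat :=
  (\sum_(i < #|edges G| | u \in enum_val i) m i)%N.

(** The exponent of the image of a monomial: its degree sequence. *)
Definition vexp G (m : 'X_{1..#|edges G|}) : 'X_{1..#|verts G|} :=
  [multinom vdeg m (enum_val j) | j < #|verts G|].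

Lemma toric_mapX G (m : 'X_{1..#|edges G|}) :
  toric_map ('X_[m] : {mpoly K[_]}) = 'X_[vexp m].
Proof.
rewrite /toric_map comp_mpolyX [RHS]mpolyXE_id.
under eq_bigr => i _ do
  rewrite tnth_mktuple /edge_monomial -prodrXl big_mkcond /=.
rewrite exchange_big; apply: eq_bigr => j _ /=.
by rewrite mnmE /vdeg -prodrXr [RHS]big_mkcond.
Qed.

(** In an element of the toric ideal, replace each monomial by a fixed
representative of its fibre under [vexp].  This changes it by an element of [J],
and the result is zero because the coefficients over each fibre add up to a
coefficient of the image. *)
Lemma toric_ideal_sub_of_cong G (J : {mpoly K[#|edges G|]} -> Prop) :
  is_ideal J -> (forall m m', vexp m = vexp m' -> cong J m m') ->
  forall f, toric_ideal f -> J f.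
Proof.
move=> idJ cJ f tf.
pose V := undup [seq vexp m | m <- msupp f].
pose rep (v : 'X_{1..#|verts G|}) : 'X_{1..#|edges G|} :=
  nth 0%MM (msupp f) (index v [seq vexp m | m <- msupp f]).
have repE m : m \in msupp f -> vexp (rep (vexp m)) = vexp m.
  move=> mf; have vm : vexp m \in [seq vexp m | m <- msupp f] by exact: map_f.
  rewrite /rep -(nth_map _ (vexp 0%MM) (@vexp G)) ?nth_index //.
  by rewrite -(size_map (@vexp G)) index_mem.
have sum0 : \sum_(m <- msupp f) f@_m *: 'X_[rep (vexp m)] = 0 :> {mpoly K[_]}.
  have /= vV m : m \in msupp f -> vexp m \in V.
    by move=> mf; rewrite mem_undup map_f.
  transitivity (\sum_(v <- V) \sum_(m <- msupp f)
                  (if vexp m == v then f@_m *: 'X_[rep v] else 0) : {mpoly K[_]}).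
    rewrite exchange_big /=; apply: eq_big_seq => m mf.
    rewrite (bigD1_seq (vexp m)) ?undup_uniq ?vV //=.
    rewrite eqxx /= big1 ?addr0 // => v; rewrite eq_sym => /negPf nv.
    by rewrite nv.
  rewrite big1 // => v _; rewrite -big_mkcond -scaler_suml.
  suff -> : \sum_(m <- msupp f | vexp m == v) f@_m = (toric_map f)@_v.
    by rewrite tf mcoeff0 scale0r.
  rewrite /toric_map comp_mpolyEX raddf_sum /= big_mkcond.
  apply: eq_bigr => m _; rewrite mcoeffZ.
  by rewrite -/(toric_map _) toric_mapX mcoeffX; case: eqP; rewrite ?mulr1 ?mulr0.
rewrite -[f]subr0 -sum0 {1}(mpolyE f) -sumrB big_seq.
apply: ideal_sum => // m mf; rewrite -scalerBr -mul_mpolyC.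
by apply: idealM => //; apply: cJ; rewrite repE.
Qed.

(** * Degree sequences *)

Lemma vdegD G (m m' : 'X_{1..#|edges G|}) u :
  vdeg (m + m')%MM u = (vdeg m u + vdeg m' u)%N.
Proof. by rewrite /vdeg -big_split; apply: eq_bigr => i _; rewrite mnmDE. Qed.

Lemma vdegU G (i : 'I_#|edges G|) u : vdeg U_(i)%MM u = (u \in enum_val i).
Proof.
rewrite /vdeg big_mkcond (bigD1 i) //= mnm1E eqxx big1 => [|j ne].
  by case: ifP; rewrite addn0.
by rewrite mnm1E eq_sym (negPf ne) if_same.
Qed.

Lemma vdeg_le_mdeg G (m : 'X_{1..#|edges G|}) u : (vdeg m u <= mdeg m)%N.
Proof.
rewrite mdegE /vdeg [leqRHS](bigID (fun i : 'I_#|edges G| => u \in enum_val i)).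
exact: leq_addr.
Qed.

Lemma sum_vdeg G (m : 'X_{1..#|edges G|}) : (\sum_u vdeg m u = (mdeg m).*2)%N.
Proof.
rewrite /vdeg (exchange_big_dep predT) //= mdegE -muln2 big_distrl /=.
apply: eq_bigr => i _; rewrite sum_nat_const mulnC; congr (_ * _)%N.
by have [_ e2] := edgesP (enum_valP i); rewrite -[2%N]e2.
Qed.

Lemma edge_ends G (i : 'I_#|edges G|) :
  exists a b, a != b /\ enum_val i = [set a; b].
Proof.
by have [_ /eqP/cards2P[a [b [ab ei]]]] := edgesP (enum_valP i); exists a, b.
Qed.

Lemma factor_edge G (m : 'X_{1..#|edges G|}) (i : 'I_#|edges G|) a b :
  enum_val i = [set a; b] -> (0 < m i)%N ->
  m = (edge_exp G a b + (m - U_(i)))%MM.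
Proof.
move=> ei mi; rewrite (edge_expE ei) addmC submK //.
by apply/mnm_lepP => j; rewrite mnm1E; case: eqP => // <-.
Qed.

Lemma exists_edge_at G (m : 'X_{1..#|edges G|}) u :
  (0 < vdeg m u)%N -> exists w r, w != u /\ m = (edge_exp G u w + r)%MM.
Proof.
rewrite lt0n sum_nat_eq0 negb_forall => /existsP[i].
rewrite negb_imply -lt0n => /andP[ui mi].
have [a [b [ab ei]]] := edge_ends i.
move: ui; rewrite ei !inE => /orP[] /eqP->.
  by exists b, (m - U_(i))%MM; rewrite eq_sym; split=> //; exact: factor_edge.
exists a, (m - U_(i))%MM; split=> //; apply: factor_edge => //.
by rewrite setUC.
Qed.

Lemma exists_edge_avoiding G (m : 'X_{1..#|edges G|}) w :
  (vdeg m w < mdeg m)%N ->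
  exists x y r, uniq [:: w; x; y] /\ m = (edge_exp G x y + r)%MM.
Proof.
rewrite mdegE [ltnRHS](bigID (fun i : 'I_#|edges G| => w \in enum_val i)).
rewrite -ltn_subLR //= subnn.
rewrite lt0n sum_nat_eq0 negb_forall => /existsP[i].
rewrite negb_imply -lt0n => /andP[wi mi].
have [x [y [xy ei]]] := edge_ends i.
exists x, y, (m - U_(i))%MM; split; last exact: factor_edge.
by move: wi; rewrite ei /= !inE xy andbT => ->.
Qed.

End Toric.

(** * Complete graphs *)

Lemma edge_complete n (a b : 'I_n) : a != b -> [set a; b] \in edges (complete_graph n).
Proof. by rewrite inE cards2 => ->. Qed.

Lemma vdeg_edge_exp n (a b u : 'I_n) : a != b ->
  vdeg (edge_exp (complete_graph n) a b) u = (u \in [set a; b]).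
Proof.
move=> ab; have Gab := edge_complete ab.
have ei := enum_rankK_in Gab Gab.
by rewrite (edge_expE ei) vdegU ei.
Qed.

Lemma mdeg_edge_exp n (a b : 'I_n) : a != b ->
  mdeg (edge_exp (complete_graph n) a b) = 1%N.
Proof.
move=> ab; have Gab := edge_complete ab.
by rewrite (edge_expE (enum_rankK_in Gab Gab)) mdeg1.
Qed.

Section Complete.
Variables (K : fieldType) (n : nat).
Local Notation G := (complete_graph n).
Local Notation E := (edge_exp G).

Variable J : {mpoly K[#|edges G|]} -> Prop.
Hypothesis idJ : is_ideal J.
Hypothesis quadJ : forall a b c d : 'I_n, uniq [:: a; b; c; d] ->
  cong J (E a b + E c d) (E a c + E b d).
Hypothesis J_toric : forall f, J f -> toric_ideal f.

Lemma switch a b c d r : uniq [:: a; b; c; d] ->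
  cong J (E a b + (E c d + r)) (E a c + (E b d + r)).
Proof. by move=> u4; rewrite !addmA; apply: congD => //; exact: quadJ. Qed.

(** When [w = v] or [z = u] the edge [uv] is already there; otherwise the four
ends are distinct and one switch creates it. *)
Lemma switch_at u v w z r : u != v -> w != u -> z != v -> w != z ->
  exists r', cong J (E u w + (E v z + r)) (E u v + r').
Proof.
move=> uv wu zv wz.
have [->|wv] := eqVneq w v; first by eexists; exact: cong_refl.
have [->|zu] := eqVneq z u.
  by rewrite addmCA (edge_expC G v); eexists; exact: cong_refl.
exists (E w z + r)%MM; apply: switch.
by rewrite /= !inE !negb_or uv wz wv (eq_sym u) wu (eq_sym u) zu (eq_sym v) zv.
Qed.

(** By [switch_at] the only obstruction is that some edge at [u] and some edge at
[v] lead to the same vertex [w].  The bound on the degree of [w] then gives an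
edge [xy] away from [w]: if it meets [u] or [v] it replaces [uw] or [vw] in
[switch_at], and otherwise switching [uw], [xy] into [ux], [wy] removes the
obstruction. *)
Lemma create_edge m u v : u != v -> (0 < vdeg m u)%N -> (0 < vdeg m v)%N ->
  (forall w, w != u -> w != v -> (vdeg m w < mdeg m)%N) ->
  exists r, cong J m (E u v + r).
Proof.
move=> uv mu mv mw.
have [w [r1 [wu mE]]] := exists_edge_at mu; rewrite {}mE {mu} in mv mw *.
have [->|wv] := eqVneq w v; first by exists r1; exact: cong_refl.
have {}mv : (0 < vdeg r1 v)%N.
  move: mv; rewrite vdegD vdeg_edge_exp 1?eq_sym // !inE.
  by rewrite (eq_sym v) (negPf uv) (eq_sym v) (negPf wv).
have [z [r2 [zv rE]]] := exists_edge_at mv; rewrite {}rE {mv} in mw *.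
have [zw|wz] := eqVneq w z; last exact: switch_at.
rewrite -{}zw {z zv} in mw *.
have /exists_edge_avoiding[x [y [r3 [wxy rE]]]] : (vdeg r2 w < mdeg r2)%N.
  have := mw w wu wv; rewrite !vdegD !mdegD !vdeg_edge_exp 1?eq_sym //.
  by rewrite !mdeg_edge_exp 1?eq_sym // !set22.
rewrite {}rE {mw r2}.
move: wxy; rewrite /= !inE !negb_or andbT => /andP[/andP[wx wy] xy].
have at_u t r : t != u -> w != t ->
    exists r', cong J (E u w + (E v w + (E u t + r))) (E u v + r').
  move=> tu wt.
  have -> : (E u w + (E v w + (E u t + r)) = E u t + (E v w + (E u w + r)))%MM.
    by rewrite addmCA (addmCA (E u w)) addmCA.
  by apply: switch_at; rewrite // eq_sym.
have at_v t r : t != v -> w != t ->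
    exists r', cong J (E u w + (E v w + (E v t + r))) (E u v + r').
  move=> tv wt; rewrite (addmCA (E v w)).
  exact: switch_at.
have [xu|xu] := eqVneq x u; first by rewrite xu; apply: at_u; rewrite // -xu eq_sym.
have [yu|yu] := eqVneq y u; first by rewrite yu (edge_expC G x);
  apply: at_u; rewrite // -yu.
have [xv|xv] := eqVneq x v; first by rewrite xv; apply: at_v; rewrite // -xv eq_sym.
have [yv|yv] := eqVneq y v; first by rewrite yv (edge_expC G x);
  apply: at_v; rewrite // -yv.
have [r' c] : exists r', cong J (E u x + (E v w + (E w y + r3))) (E u v + r').
  by apply: switch_at; rewrite // eq_sym.
exists r'; apply: (cong_trans idJ _ c).
have -> : (E u w + (E v w + (E x y + r3)) = E u w + (E x y + (E v w + r3)))%MM.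
  by rewrite (addmCA (E v w)).
rewrite (addmCA (E v w)); apply: switch.
by rewrite /= !inE !negb_or wx wy xy (eq_sym u) wu (eq_sym u) xu (eq_sym u) yu.
Qed.

Lemma vexp_vdeg (m m' : 'X_{1..#|edges G|}) : vexp m = vexp m' -> vdeg m =1 vdeg m'.
Proof.
move=> e u; have uG : u \in verts G by rewrite inE.
by move/mnmP/(_ (enum_rank_in uG u)): e; rewrite !mnmE enum_rankK_in.
Qed.

Lemma eq_vdeg_mdeg (m m' : 'X_{1..#|edges G|}) : vdeg m =1 vdeg m' -> mdeg m = mdeg m'.
Proof.
move=> e; apply: double_inj; rewrite -!sum_vdeg.
by apply: eq_bigr => u _; rewrite e.
Qed.

Lemma cong_vdeg (m m' : 'X_{1..#|edges G|}) : cong J m m' -> vdeg m =1 vdeg m'.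
Proof.
move/J_toric; rewrite /toric_ideal /toric_map comp_mpolyB.
rewrite -!/(toric_map _) !toric_mapX => /eqP; rewrite subr_eq0 => /eqP e.
apply: vexp_vdeg; apply/eqP; have := mcoeffX K (vexp m) (vexp m').
by rewrite e mcoeffX eqxx; case: eqP => // _ /eqP; rewrite oner_eq0.
Qed.

(** Induction on the number of edges: an edge [uv] of [m'] is created in [m] and
cancelled.  The degree bound of [create_edge] is inherited from [m'], whose edge
[uv] misses every other vertex. *)
Lemma cong_of_vdeg (m m' : 'X_{1..#|edges G|}) : vdeg m =1 vdeg m' -> cong J m m'.
Proof.
move dE : (mdeg m') => d; elim: d => [|d IHd] in m m' dE * => eq_deg.
  have := eq_vdeg_mdeg eq_deg; rewrite dE.
  move/eqP: dE; rewrite mdeg_eq0 => /eqP-> /eqP; rewrite mdeg_eq0 => /eqP->.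
  exact: cong_refl.
have /existsP[i mi] : [exists i, (0 < m' i)%N].
  apply: contra_eqT dE; rewrite negb_exists => /forallP m0.
  by rewrite mdegE big1 // => i _; apply/eqP; rewrite -leqn0 leqNgt.
have [u [v [uv ei]]] := edge_ends i.
have mE := factor_edge ei mi; move: (m' - U_(i))%MM mE => r' mE.
rewrite {m' mi}mE in dE eq_deg *.
have r'd : mdeg r' = d by move: dE; rewrite mdegD mdeg_edge_exp // => -[].
have [r c] : exists r, cong J m (E u v + r).
  apply: create_edge => // [||w wu wv].
  - by rewrite eq_deg vdegD vdeg_edge_exp // set21.
  - by rewrite eq_deg vdegD vdeg_edge_exp // set22.
  - rewrite eq_deg (eq_vdeg_mdeg eq_deg) dE vdegD vdeg_edge_exp // !inE.
    by rewrite (negPf wu) (negPf wv) ltnS -r'd vdeg_le_mdeg.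
apply: (cong_trans idJ c); rewrite !(addmC (E u v)); apply: congD => //.
apply: IHd => // w; apply/(@addnI (vdeg (E u v) w)); rewrite -!vdegD.
by rewrite -(cong_vdeg c).
Qed.

Lemma toric_ideal_complete_sub f : toric_ideal f -> J f.
Proof.
apply: toric_ideal_sub_of_cong => // m m' /vexp_vdeg; exact: cong_of_vdeg.
Qed.

End Complete.

(** * Splitting off two edges at a vertex *)

Lemma edge_deletedP (T : finType) (G : graph T) e f :
  f \in edges G :\ e -> f \subset verts G /\ #|f| = 2.
Proof. by case/setD1P=> _; exact: edgesP. Qed.

Definition edge_deleted (T : finType) (G : graph T) (e : {set T}) : graph T :=
  Graph (@edge_deletedP T G e).

Lemma edge_deleted_subgraph (T : finType) (G : graph T) e :
  subgraph (edge_deleted G e) G.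
Proof. by rewrite /subgraph subxx subD1set. Qed.

Lemma eq_set2 (T : finType) (a b x y : T) :
  ([set a; b] == [set x; y]) = ((a == x) && (b == y)) || ((a == y) && (b == x)).
Proof.
rewrite eqEsubset !subUset !sub1set !inE (eq_sym x) (eq_sym x) (eq_sym y) (eq_sym y).
by case: (a == x); case: (a == y); case: (b == x); case: (b == y).
Qed.

(** The four edges of the quadric [ab.cd - ac.bd]. *)
Definition quadric_edges (T : finType) (a b c d : T) : seq {set T} :=
  [:: [set a; b]; [set c; d]; [set a; c]; [set b; d]].

Lemma edge_deleted_quadric (K : fieldType) n e (a b c d : 'I_n) :
  uniq [:: a; b; c; d] -> e \notin quadric_edges a b c d ->
  cong (toric_ideal_ext (K := K) (edge_deleted_subgraph (complete_graph n) e))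
       (edge_exp _ a b + edge_exp _ c d) (edge_exp _ a c + edge_exp _ b d).
Proof.
move=> u4; rewrite !inE !negb_or => /and4P[eab ecd eac ebd].
move: (u4); rewrite /= !inE !negb_or => /and4P[/and3P[ab ac ad] /andP[bc bd] cd _].
by apply: quadric_ext => //; rewrite in_setD1 edge_complete // eq_sym andbT.
Qed.

Lemma edge_deleted_ext_neq (K : fieldType) n (a b c d : 'I_n) : uniq [:: a; b; c; d] ->
  let s := edge_deleted_subgraph (complete_graph n) [set a; b] in
  ~ ideal_eq (toric_ideal_ext (K := K) s)
    (@toric_ideal K _ (complete_graph n)).
Proof.
move=> u4 s; move: (u4).
rewrite /= !inE !negb_or => /and4P[/and3P[ab ac ad] /andP[bc bd] cd _].
apply: (missing_edge_ext_neq (s := s) u4);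
  rewrite ?edge_complete // in_setD1 ?eqxx //.
  by rewrite edge_complete // eq_set2 eqxx /= (eq_sym c) (negPf bc) (negPf ab).
rewrite edge_complete // eq_set2 (eq_sym b a) (negPf ab) /=.
by rewrite (eq_sym d) (negPf ad) andbF.
Qed.

Section Splitting.
Variables (K : fieldType) (n : nat) (p q r : 'I_n).
Hypothesis pqr : uniq [:: p; q; r].
Local Notation G := (complete_graph n).
Local Notation E := (edge_exp G).
Local Notation Gq := (edge_deleted_subgraph G [set p; q]).
Local Notation Gr := (edge_deleted_subgraph G [set p; r]).
Local Notation J :=
  (ideal_add (toric_ideal_ext (K := K) Gq) (toric_ideal_ext (K := K) Gr)).

Lemma sum_ext_is_ideal : is_ideal J.
Proof. by apply: ideal_add_is_ideal; apply: ideal_gen_is_ideal. Qed.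

Lemma sum_ext_quadric_avoiding a b c d : uniq [:: a; b; c; d] ->
  ([set p; q] \notin quadric_edges a b c d)
  || ([set p; r] \notin quadric_edges a b c d) ->
  cong J (E a b + E c d) (E a c + E b d).
Proof.
move=> u4 /orP[/(edge_deleted_quadric K u4) cq|/(edge_deleted_quadric K u4) cr].
  eexists; exists 0; rewrite addr0; split; [exact: cq | | by []].
  exact: ideal0 (ideal_gen_is_ideal _).
exists 0; eexists; rewrite add0r; split; [ | exact: cr | by []].
exact: ideal0 (ideal_gen_is_ideal _).
Qed.

(** If both deleted edges occur, one is in [ab.cd] and the other in [ac.bd], as
two edges at [p] are not disjoint.  Hence of the two quadrics [ab.cd - ad.bc]
and [ad.bc - ac.bd] each avoids one of them. *)
Lemma sum_ext_quadric a b c d : uniq [:: a; b; c; d] ->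
  cong J (E a b + E c d) (E a c + E b d).
Proof.
move=> u4.
have [|] := boolP (([set p; q] \notin quadric_edges a b c d)
                   || ([set p; r] \notin quadric_edges a b c d)).
  exact: sum_ext_quadric_avoiding u4.
rewrite negb_or !negbK => /andP[].
rewrite !inE !eq_set2; move: pqr (u4); rewrite /= !inE !negb_or !andbT.
move=> /andP[/andP[pq pr] qr] /and3P[/and3P[ab ac ad] /andP[bc bd] cd].
have ne (x y : 'I_n) : x != y -> ((x == y = false) * (y == x = false))%type.
  by move=> xy; split; [|rewrite eq_sym]; exact: negPf xy.
have neqs := (ne _ _ ab, ne _ _ ac, ne _ _ ad, ne _ _ bc, ne _ _ bd, ne _ _ cd).
move=> pqE prE.
apply: (cong_trans sum_ext_is_ideal (t := (E a d + E b c)%MM)).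
  rewrite (edge_expC G c); apply: sum_ext_quadric_avoiding.
    by rewrite /= !inE !neqs.
  rewrite !inE !eq_set2; move: pqE prE pq pr qr.
  (* The place of [pq] determines [p] and [q]; that of [pr] then determines [r]. *)
  by case/or4P=> /orP[] /andP[/eqP-> /eqP->]; rewrite ?eqxx ?neqs ?orbF ?andbT /=;
     case/orP=> /eqP->; rewrite ?eqxx ?neqs.
rewrite (edge_expC G b c) (edge_expC G b d); apply: sum_ext_quadric_avoiding.
  by rewrite /= !inE !neqs.
rewrite !inE !eq_set2; move: pqE prE pq pr qr.
by case/or4P=> /orP[] /andP[/eqP-> /eqP->]; rewrite ?eqxx ?neqs ?orbF ?andbT /=;
   case/orP=> /eqP->; rewrite ?eqxx ?neqs.
Qed.

Lemma sum_ext_toric f : J f -> @toric_ideal K _ G f.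
Proof.
move=> [x [y [/toric_ideal_ext_sub Ix /toric_ideal_ext_sub Iy ->]]].
exact: idealD (toric_ideal_is_ideal _ _) _ _ Ix Iy.
Qed.

End Splitting.

Lemma complete_splitting (K : fieldType) n (p q r s : 'I_n) :
  uniq [:: p; q; r; s] ->
  subgraph_splitting K (edge_deleted_subgraph (complete_graph n) [set p; q])
                       (edge_deleted_subgraph (complete_graph n) [set p; r]).
Proof.
move=> u4; have pqr : uniq [:: p; q; r] by have := take_uniq 3 u4.
have u4' : uniq [:: p; r; q; s].
  move: u4; rewrite /= !inE !negb_or (eq_sym r q).
  by case/and4P=> /and3P[-> -> ->] /andP[-> ->] ->.
split; [|exact: edge_deleted_ext_neq u4|exact: edge_deleted_ext_neq u4'].
move=> f; split; last exact: sum_ext_toric.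
apply: toric_ideal_complete_sub; last exact: sum_ext_toric.
  exact: sum_ext_is_ideal.
by move=> a b c d; exact: sum_ext_quadric.
Qed.

(** With fewer than four vertices there is no quadric, so the zero ideal contains
them all. *)
Lemma toric_ideal_complete_small (K : fieldType) n f :
  (n < 4)%N -> @toric_ideal K _ (complete_graph n) f -> f = 0.
Proof.
move=> n4; apply: (toric_ideal_complete_sub (J := fun f => f = 0)).
- by split=> [|x y -> ->|c x ->]; rewrite ?addr0 ?mulr0.
- move=> a b c d /card_uniqP u4.
  by have := max_card (mem [:: a; b; c; d]); rewrite u4 card_ord leqNgt n4.
- by move=> _ ->; apply: ideal0; exact: toric_ideal_is_ideal.
Qed.

Theorem theorem3p2 (K : fieldType) (n : nat) (hn : (1 <= n)%N) :
  subgraph_splittable K (complete_graph n) <-> (4 <= n)%N.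
Proof.
split=> [[G1 [G2 [s1 [s2 [_ ne1 _]]]]]|n4].
  rewrite leqNgt; apply/negP => n4; apply: ne1 => f.
  split=> [/toric_ideal_ext_sub|] //.
  move/(toric_ideal_complete_small n4)->.
  exact: ideal0 (ideal_gen_is_ideal _).
case: n n4 {hn} => [|[|[|[|n]]]] // _.
pose v k : 'I_n.+4 := inord k.
eexists; eexists; eexists; eexists.
apply: (@complete_splitting K _ (v 0%N) (v 1%N) (v 2%N) (v 3%N)).
by rewrite /= !inE -!val_eqE /= !inordK.
Qed.
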